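(* Let $(L,\cdot)$ be a quasigroup (respectively, loop) with holomorph $H(L)$. Then $H(L)$ is an AIPQ (respectively, AIPL) if and only if all three of the following hold: 1. $AUM(L)$ is an abelian group; 2. $(\beta^{-1},\alpha,I)\in AUT(L)$ for all $\alpha,\beta\in AUM(L)$; 3. $L$ is an AIPQ (respectively, AIPL).
   Context: Mappings are written on the right of their arguments, so $x\alpha$ is the image of $x$ under $\alpha$, and $\alpha\beta$ means first $\alpha$, then $\beta$; $I$ is the identity map. A quasigroup $(L,\cdot)$ is a non-empty set with a binary operation such that for all $a,b\in L$ the equations $a\cdot x=b$ and $y\cdot a=b$ have unique solutions $x,y\in L$. A loop is a quasigroup with a (unique) two-sided identity element $e$. For $x\in L$, the right inverse $x^\rho=xJ_\rho$ and the left inverse $x^\lambda=xJ_\lambda$ are the elements with $x\cdot x^\rho=e^\rho$ and $x^\lambda\cdot x=e^\lambda$, where $e^\rho$ and $e^\lambda$ are the right and left identity elements; whenever inverses are used in a quasigroup these elements are assumed to exist (in a loop both equal $e$). $AUT(L)$ (the autotopism group) is the group, under componentwise composition, of all triples $(A,B,C)$ of bijections of $L$ with $xA\cdot yB=(x\cdot y)C$ for all $x,y\in L$. $AUM(L)$ is the automorphism group: the group of bijections $A$ of $L$ with $xA\cdot yA=(x\cdot y)A$ for all $x,y\in L$. The holomorph $H(L)$ is the set of pairs $(\alpha,x)$ with $\alpha\in AUM(L)$, $x\in L$, with operation $(\alpha,x)\circ(\beta,y)=(\alpha\beta,\ x\beta\cdot y)$. A quasigroup (loop) is an AIPQ (AIPL),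 i.e. an automorphic inverse property quasigroup (loop), if it satisfies $(xy)^\rho=x^\rho y^\rho$ for all $x,y$, or equivalently $(xy)^\lambda=x^\lambda y^\lambda$ for all $x,y$. *)

(* Defs.v *)
From mathcomp Require Import ssreflect ssrfun ssrbool.
From Stdlib Require Import FunctionalExtensionality ProofIrrelevance.
From Stdlib Require Import ClassicalEpsilon.

Set Implicit Arguments.
Unset Strict Implicit.
Unset Printing Implicit Defensive.

Definition quasigroup (L : Type) (op : L -> L -> L) : Prop :=
  [/\ inhabited L,
      forall a b : L, exists! x, op a x = b
    & forall a b : L, exists! y, op y a = b].

Definition loop (L : Type) (op : L -> L -> L) : Prop :=
  quasigroup op /\ exists e, left_id e op /\ right_id e op.

Definition abelian_group (G : Type) (mul : G -> G -> G) : Prop :=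
  [/\ associative mul, commutative mul
    & exists (e : G) (inv : G -> G),
        [/\ left_id e mul, right_id e mul, left_inverse e inv mul
          & right_inverse e inv mul]].

(* The triple (A, B, C) lies in AUT(L, op). *)
Definition autotopism (L : Type) (op : L -> L -> L) (A B C : L -> L) : Prop :=
  [/\ bijective A, bijective B, bijective C
    & forall x y, op (A x) (B y) = C (op x y)].

(* AUM(L, op). The two-sided inverse is stored as data; it is determined by
   [aut_fun], so equality in [aut op] is equality of the maps ([aut_eq]). *)
Record aut (L : Type) (op : L -> L -> L) := Aut {
  aut_fun :> L -> L;
  aut_invfun : L -> L;
  aut_funK : cancel aut_fun aut_invfun;
  aut_invfunK : cancel aut_invfun aut_fun;
  aut_morph : {morph aut_fun : x y / op x y}
}.

Lemma aut_eq (L : Type) (op : L -> L -> L) (a b : aut op) : a =1 b -> a = b.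
Proof.
case: a b => [f f' fK f'K fM] [g g' gK g'K gM] /= fg.
have e : f = g by apply: functional_extensionality.
subst g.
have e' : f' = g'.
  by apply: functional_extensionality => x; rewrite -{1}(g'K x) fK.
by subst g'; congr Aut; apply: proof_irrelevance.
Qed.

Section AutOps.
Variables (L : Type) (op : L -> L -> L).
Implicit Types a b : aut op.

Lemma aut_mulK a b : cancel (b \o a) (aut_invfun a \o aut_invfun b).
Proof. by move=> x /=; rewrite aut_funK aut_funK. Qed.

Lemma aut_mulVK a b : cancel (aut_invfun a \o aut_invfun b) (b \o a).
Proof. by move=> x /=; rewrite aut_invfunK aut_invfunK. Qed.

Lemma aut_mul_morph a b : {morph b \o a : x y / op x y}.
Proof. by move=> x y /=; rewrite !aut_morph. Qed.

(* Maps act on the right: the product "a b" is first [a], then [b]. *)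
Definition aut_mul a b : aut op :=
  Aut (@aut_mulK a b) (@aut_mulVK a b) (@aut_mul_morph a b).

Lemma aut_inv_morph a : {morph aut_invfun a : x y / op x y}.
Proof.
by move=> x y; rewrite -{1}(aut_invfunK a x) -{1}(aut_invfunK a y)
  -aut_morph aut_funK.
Qed.

Definition aut_inv a : aut op :=
  Aut (aut_invfunK a) (aut_funK a) (@aut_inv_morph a).

Definition holomorph : Type := (aut op * L)%type.

Definition hol_mul (p q : holomorph) : holomorph :=
  (aut_mul p.1 q.1, op (q.1 p.2) q.2).

End AutOps.

(* (xy)^rho = x^rho y^rho, where x^rho = J x is defined by x x^rho = e with e
   the right identity; its existence is part of the property. In a quasigroup
   e and J are unique. *)
Definition aip_rho (L : Type) (op : L -> L -> L) : Prop :=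
  exists (e : L) (J : L -> L),
    [/\ right_id e op, right_inverse e J op & {morph J : x y / op x y}].

(* (xy)^lambda = x^lambda y^lambda, with e the left identity. *)
Definition aip_lambda (L : Type) (op : L -> L -> L) : Prop :=
  exists (e : L) (J : L -> L),
    [/\ left_id e op, left_inverse e J op & {morph J : x y / op x y}].

(* A quasigroup with both one-sided identities is a loop, and only then do the
   two inverse maps exist together; for quasigroups the two forms of the
   automorphic inverse property are therefore kept apart. *)
Definition AIPQ_rho (L : Type) (op : L -> L -> L) : Prop :=
  quasigroup op /\ aip_rho op.

Definition AIPQ_lambda (L : Type) (op : L -> L -> L) : Prop :=
  quasigroup op /\ aip_lambda op.

Lemma aip_rho_lambda (L : Type) (op : L -> L -> L) :
  loop op -> (aip_rho op <-> aip_lambda op).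
Proof.
move=> [[_ lq rq] [e [le re]]]; split=> -[e' [J [idJ invJ JM]]].
- have e'E : e' = e by rewrite -(le e') idJ.
  subst e'.
  pose K x := proj1_sig (constructive_indefinite_description _ (rq x e)).
  have KE x : op (K x) x = e.
    by rewrite /K; case: constructive_indefinite_description => y [].
  have KU x y : op y x = e -> y = K x.
    by move=> yx; case: (rq x e) => z [_ zU]; rewrite -(zU y yx) -(zU _ (KE x)).
  have KJ x : J (K x) = x.
    by case: (lq (K x) e) => z [_ zU]; apply: etrans (zU _ (KE x)); apply/esym/zU.
  exists e, K; split=> // x y; apply: esym; apply: KU.
  by rewrite -{2}(KJ x) -{2}(KJ y) -JM invJ.
- have e'E : e' = e by rewrite -(re e') idJ.
  subst e'.
  pose K x := proj1_sig (constructive_indefinite_description _ (lq x e)).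
  have KE x : op x (K x) = e.
    by rewrite /K; case: constructive_indefinite_description => y [].
  have KU x y : op x y = e -> y = K x.
    by move=> yx; case: (lq x e) => z [_ zU]; rewrite -(zU y yx) -(zU _ (KE x)).
  have KJ x : J (K x) = x.
    by case: (rq (K x) e) => z [_ zU]; apply: etrans (zU _ (KE x)); apply/esym/zU.
  exists e, K; split=> // x y; apply: esym; apply: KU.
  by rewrite -{1}(KJ x) -{1}(KJ y) -JM invJ.
Qed.

(* By [aip_rho_lambda] the choice of side is immaterial for loops. *)
Definition AIPL (L : Type) (op : L -> L -> L) : Prop :=
  loop op /\ aip_rho op.

(* Main.v *)
Require Import Defs.
From mathcomp Require Import ssreflect ssrfun ssrbool.

(** Both sides of each equivalence say that the automorphism group of L is
    trivial and that L itself has the automorphic inverse property.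

    On the right-hand side this is cancellation: if every (beta^-1, alpha, I)
    is an autotopism, then so is (I, alpha, I), that is,
    x . (y alpha) = x . y, and so alpha = I ([autotopisms_aut_trivial]).

    On the left-hand side, one-sided inverses in H(L) are given by
    (alpha, x) |-> (alpha^-1, x^J alpha^-1), where J is the inverse map of L.
    If this map respects products, then so does J, and the product
    (alpha, x) o (I, y) = (alpha, x . y) yields
      (x^J alpha^-1) . (y^J alpha^-1) = (x^J alpha^-1) . y^J.
    Every element of L has the form y^J, so alpha^-1 fixes L pointwise
    ([hol_inverse_aut_trivial]).

    Once the automorphism group is trivial, H(L) and L are isomorphic through
    the second projection, and the automorphic inverse property passes from
    each to the other. *)

Set Implicit Arguments.
Unset Strict Implicit.
Unset Printing Implicit Defensive.

(** * Cancellation and fixed identities in quasigroups *)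

Section Quasigroup.
Variables (L : Type) (op : L -> L -> L).
Hypothesis qop : quasigroup op.

Lemma quasigroup_cancell a : injective (op a).
Proof.
case: qop => _ lq _ x y xy.
by case: (lq a (op a y)) => z [_ zU]; rewrite -(zU x xy) -(zU y erefl).
Qed.

Lemma quasigroup_cancelr a : injective (op^~ a).
Proof.
case: qop => _ _ rq x y /= xy.
by case: (rq a (op y a)) => z [_ zU]; rewrite -(zU x xy) -(zU y erefl).
Qed.

Lemma aut_right_id e (a : aut op) : right_id e op -> a e = e.
Proof.
by move=> re; apply: (@quasigroup_cancell (a e)); rewrite -aut_morph !re.
Qed.

End Quasigroup.

(** * Transfer along isomorphisms *)

Section Isomorphism.
Variables (G H : Type) (opG : G -> G -> G) (opH : H -> H -> H).
Variables (f : G -> H) (g : H -> G).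
Hypotheses (fK : cancel f g) (gK : cancel g f).
Hypothesis fM : {morph f : x y / opG x y >-> opH x y}.

Lemma iso_opE a b : opH a b = f (opG (g a) (g b)).
Proof. by rewrite fM !gK. Qed.

Lemma iso_quasigroup : quasigroup opG -> quasigroup opH.
Proof.
case=> [[x0] lq rq]; split; first by exists; exact: f x0.
- move=> a b; case: (lq (g a) (g b)) => x [xE xU].
  exists (f x); split=> [|y yE]; first by rewrite iso_opE fK xE gK.
  by rewrite (xU (g y)) ?gK // -yE iso_opE fK.
- move=> a b; case: (rq (g a) (g b)) => x [xE xU].
  exists (f x); split=> [|y yE]; first by rewrite iso_opE fK xE gK.
  by rewrite (xU (g y)) ?gK // -yE iso_opE fK.
Qed.

Lemma iso_loop : loop opG -> loop opH.
Proof.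
case=> qG [e [le re]]; split; first exact: iso_quasigroup.
by exists (f e); split=> x; rewrite iso_opE fK ?le ?re gK.
Qed.

Lemma iso_aip_rho : aip_rho opG -> aip_rho opH.
Proof.
case=> e [J [re Jr JM]]; exists (f e), (f \o J \o g); split=> [x|x|x y] /=.
- by rewrite iso_opE fK re gK.
- by rewrite iso_opE fK Jr.
- by rewrite iso_opE fK JM fM.
Qed.

Lemma iso_aip_lambda : aip_lambda opG -> aip_lambda opH.
Proof.
case=> e [J [le Jl JM]]; exists (f e), (f \o J \o g); split=> [x|x|x y] /=.
- by rewrite iso_opE fK le gK.
- by rewrite iso_opE fK Jl.
- by rewrite iso_opE fK JM fM.
Qed.

End Isomorphism.

(** * Holomorphs and trivial automorphism groups *)

Section Holomorph.
Variables (L : Type) (op : L -> L -> L).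

Definition aut_id : aut op :=
  @Aut L op id id (fun _ => erefl) (fun _ => erefl) (fun _ _ => erefl).

Definition aut_trivial := forall a : aut op, a =1 id.

Lemma autotopisms_aut_trivial :
  quasigroup op ->
  (forall alpha beta : aut op, autotopism op (aut_inv beta) alpha id) ->
  aut_trivial.
Proof.
move=> qop autot a x; case: (autot a aut_id) => _ _ _ aE.
exact: quasigroup_cancell qop _ _ _ (aE x x).
Qed.

Lemma aut_trivial_autotopism (alpha beta : aut op) :
  aut_trivial -> autotopism op (aut_inv beta) alpha id.
Proof.
move=> triv; split; last by move=> x y; rewrite !triv.
- by exists beta; [exact: aut_invfunK | exact: aut_funK].
- by exists (aut_inv alpha); [exact: aut_funK | exact: aut_invfunK].
- by exists id.
Qed.

Lemma aut_trivial_abelian : aut_trivial -> abelian_group (@aut_mul L op).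
Proof.
move=> triv; have autE (a b : aut op) : a = b.
  by apply: aut_eq => x; rewrite !triv.
split=> [a b c|a b|]; try exact: autE.
by exists aut_id, (@aut_inv L op); split=> a; exact: autE.
Qed.

Section TrivialAut.
Hypothesis triv : aut_trivial.

Definition hol_embed (x : L) : holomorph op := (aut_id, x).

Lemma hol_sndK : cancel snd hol_embed.
Proof. by case=> a x; congr pair; apply: aut_eq => y; rewrite [RHS]triv. Qed.

Lemma hol_embedK : cancel hol_embed snd.
Proof. by []. Qed.

Lemma hol_snd_morph : {morph snd : p q / @hol_mul L op p q >-> op p q}.
Proof. by move=> p q /=; rewrite triv. Qed.

Lemma hol_embed_morph : {morph hol_embed : x y / op x y >-> @hol_mul L op x y}.
Proof. by move=> x y; rewrite -[RHS]hol_sndK. Qed.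

Lemma hol_quasigroup_iff : quasigroup (@hol_mul L op) <-> quasigroup op.
Proof.
split; first exact: iso_quasigroup hol_sndK hol_embedK hol_snd_morph.
exact: iso_quasigroup hol_embedK hol_sndK hol_embed_morph.
Qed.

Lemma hol_loop_iff : loop (@hol_mul L op) <-> loop op.
Proof.
split; first exact: iso_loop hol_sndK hol_embedK hol_snd_morph.
exact: iso_loop hol_embedK hol_sndK hol_embed_morph.
Qed.

Lemma hol_aip_rho_iff : aip_rho (@hol_mul L op) <-> aip_rho op.
Proof.
split; first exact: iso_aip_rho hol_sndK hol_embedK hol_snd_morph.
exact: iso_aip_rho hol_embedK hol_sndK hol_embed_morph.
Qed.

Lemma hol_aip_lambda_iff : aip_lambda (@hol_mul L op) <-> aip_lambda op.
Proof.
split; first exact: iso_aip_lambda hol_sndK hol_embedK hol_snd_morph.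
exact: iso_aip_lambda hol_embedK hol_sndK hol_embed_morph.
Qed.

End TrivialAut.

(** * Inverses in the holomorph *)

Section Inverses.
Hypothesis qop : quasigroup op.

(** The hypothesis on J is a formula that left and right inverses in the
    holomorph have in common, so one argument serves both versions of the
    automorphic inverse property. Surjectivity of K is what turns a statement
    about inverses in L into one about all of L. *)
Lemma hol_inverse_aut_trivial (J : holomorph op -> holomorph op) (K : L -> L) :
  {morph J : p q / hol_mul p q} ->
  (forall a x, J (a, x) = (aut_inv a, aut_inv a (K x))) ->
  (forall y, exists x, K x = y) ->
  aut_trivial.
Proof.
move=> JM JE Ksurj.
have KM : {morph K : x y / op x y}.
  move=> x y; have /(congr1 snd) := JM (aut_id, x) (aut_id, y).
  by rewrite /hol_mul !JE.
move=> a y; have [x <-] := Ksurj y.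
(* Since (a, x) o (I, x) = (a, x . x), this compares a^-1 (K x) . a^-1 (K x)
   with a^-1 (K x) . K x. *)
have /(congr1 snd) := JM (a, x) (aut_id, x).
rewrite /hol_mul !JE /= KM aut_inv_morph => /(quasigroup_cancell qop) aKx.
by rewrite -{1}aKx aut_invfunK.
Qed.

(** If i = (I, u), a right inverse (a^-1, y) of (a, x) satisfies
    (x a^-1) . y = u. Automorphisms fix the right identity u, so the image under
    a^-1 of the right inverse of x solves this equation. *)
Lemma hol_rinverseE (i : holomorph op) (J : holomorph op -> holomorph op) :
  right_id i (@hol_mul L op) -> right_inverse i J (@hol_mul L op) ->
  exists K : L -> L,
    (forall a x, J (a, x) = (aut_inv a, aut_inv a (K x))) /\
    (forall y, exists x, K x = y).
Proof.
case: i => i u ri Jr.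
have iE z : i z = z.
  exact: (congr1 (fun p : holomorph op => p.1 z) (ri (aut_id, u))).
have ru : right_id u op.
  by move=> x; rewrite -{1}(iE x); exact: (congr1 snd (ri (aut_id, x))).
have J1 a x : (J (a, x)).1 = aut_inv a.
  apply: aut_eq => z; rewrite -[RHS]iE -{1}(aut_invfunK a z).
  exact: (congr1 (fun p : holomorph op => p.1 (aut_inv a z)) (Jr (a, x))).
have J2 a x : op (aut_inv a x) (J (a, x)).2 = u.
  by rewrite -(J1 a x); exact: (congr1 snd (Jr (a, x))).
exists (fun x => (J (aut_id, x)).2); split=> [a x|y].
  rewrite [LHS]surjective_pairing J1; congr pair.
  apply: (@quasigroup_cancell L op qop (aut_inv a x)).
  by rewrite J2 -(aut_morph (aut_inv a)) (J2 aut_id) (aut_right_id qop).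
case: (qop) => _ _ /(_ y u) [x [xy _]]; exists x.
by apply: (@quasigroup_cancell L op qop x); rewrite xy; exact: (J2 aut_id).
Qed.

(** Here a left inverse (a^-1, y) of (a, x) satisfies (y a) . x = u, so y a is
    the left inverse of x. *)
Lemma hol_linverseE (i : holomorph op) (J : holomorph op -> holomorph op) :
  left_id i (@hol_mul L op) -> left_inverse i J (@hol_mul L op) ->
  exists K : L -> L,
    (forall a x, J (a, x) = (aut_inv a, aut_inv a (K x))) /\
    (forall y, exists x, K x = y).
Proof.
case: i => i u li Jl.
have iE z : i z = z.
  exact: (congr1 (fun p : holomorph op => p.1 z) (li (aut_id, u))).
have J1 a x : (J (a, x)).1 = aut_inv a.
  apply: aut_eq => z; rewrite -[LHS](aut_funK a); congr (aut_inv a _).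
  by rewrite -[RHS]iE; exact: (congr1 (fun p : holomorph op => p.1 z) (Jl (a, x))).
have J2 (a : aut op) x : op (a (J (a, x)).2) x = u.
  exact: (congr1 snd (Jl (a, x))).
exists (fun x => (J (aut_id, x)).2); split=> [a x|y].
  rewrite [LHS]surjective_pairing J1; congr pair.
  rewrite -[LHS](aut_funK a); congr (aut_inv a _).
  by apply: (@quasigroup_cancelr L op qop x); rewrite /= J2 -(J2 aut_id x).
case: (qop) => _ /(_ y u) [x [yx _]] _; exists x.
by apply: (@quasigroup_cancelr L op qop x); rewrite /= yx; exact: (J2 aut_id).
Qed.

Lemma hol_aip_rho_aut_trivial : aip_rho (@hol_mul L op) -> aut_trivial.
Proof.
case=> i [J [ri Jr JM]]; have [K [JE Ksurj]] := hol_rinverseE ri Jr.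
exact: hol_inverse_aut_trivial JM JE Ksurj.
Qed.

Lemma hol_aip_lambda_aut_trivial : aip_lambda (@hol_mul L op) -> aut_trivial.
Proof.
case=> i [J [li Jl JM]]; have [K [JE Ksurj]] := hol_linverseE li Jl.
exact: hol_inverse_aut_trivial JM JE Ksurj.
Qed.

(** P and Q are to be one version of the automorphic inverse property, for the
    holomorph and for L. Each version then needs only two facts: it forces a
    trivial automorphism group, and it transfers once that group is trivial. *)
Lemma hol_iff_of_aut_trivial (P Q : Prop) :
  (P -> aut_trivial) -> (aut_trivial -> (P <-> Q)) ->
  P <-> [/\ abelian_group (@aut_mul L op),
            forall alpha beta : aut op,
              autotopism op (aut_inv beta) alpha id
          & Q].
Proof.
move=> Ptriv PQ; split=> [p|[_ /(autotopisms_aut_trivial qop) triv q]].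
- have triv := Ptriv p; split; last by apply/PQ.
  + exact: aut_trivial_abelian.
  + by move=> alpha beta; exact: aut_trivial_autotopism.
- by apply/PQ.
Qed.

End Inverses.

End Holomorph.

(** * The holomorph characterization *)

Theorem theorem2p1 (L : Type) (op : L -> L -> L) :
  (quasigroup op ->
     (AIPQ_rho (@hol_mul L op) <->
        [/\ abelian_group (@aut_mul L op),
            forall alpha beta : aut op,
              autotopism op (aut_inv beta) alpha id
          & AIPQ_rho op])
     /\
     (AIPQ_lambda (@hol_mul L op) <->
        [/\ abelian_group (@aut_mul L op),
            forall alpha beta : aut op,
              autotopism op (aut_inv beta) alpha id
          & AIPQ_lambda op]))
  /\
  (loop op ->
     (AIPL (@hol_mul L op) <->
        [/\ abelian_group (@aut_mul L op),
            forall alpha beta : aut op,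
              autotopism op (aut_inv beta) alpha id
          & AIPL op])).
Proof.
split=> [qop|lop].
- split; apply: hol_iff_of_aut_trivial => //.
  + by case=> _ /(hol_aip_rho_aut_trivial qop).
  + by move=> triv; rewrite /AIPQ_rho hol_quasigroup_iff // hol_aip_rho_iff.
  + by case=> _ /(hol_aip_lambda_aut_trivial qop).
  + by move=> triv; rewrite /AIPQ_lambda hol_quasigroup_iff // hol_aip_lambda_iff.
- have qop := proj1 lop; apply: hol_iff_of_aut_trivial => //.
  + by case=> _ /(hol_aip_rho_aut_trivial qop).
  + by move=> triv; rewrite /AIPL hol_loop_iff // hol_aip_rho_iff.
Qed.
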